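(* Let $\Lambda=\{\lambda_1,\lambda_2,\ldots,\lambda_n\}$ be a realizable list of complex numbers with $\lambda_1>0$, $\operatorname{Re}\lambda_i\le 0$ and $\lambda_i\ne 0$ for $i=2,\ldots,n$, and $s_1(\Lambda)>0$. Suppose there is a decomposition of $\Lambda$ (as a disjoint union of multisets) $$\Lambda=\Lambda_1\cup\Lambda_2\cup\cdots\cup\Lambda_t,\qquad \Lambda_k=\{\lambda_{k1},\lambda_{k2},\ldots,\lambda_{kp_k}\}\ (p_k\ge 1),\qquad \lambda_{11}=\lambda_1,$$ such that each of the auxiliary lists $$\Gamma_1=\Lambda_1,\qquad \Gamma_k=\{s_1(\Gamma_{k-1}),\lambda_{k1},\lambda_{k2},\ldots,\lambda_{kp_k}\},\quad k=2,\ldots,t,$$ is the spectrum of a diagonalizable nonnegative companion matrix $A_k$ having a positive column. Then $\Lambda$ is universally realizable.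
   Context: Lists are multisets of complex numbers (repetitions allowed). A list $\Lambda=\{\lambda_1,\ldots,\lambda_n\}$ is realizable if it is the spectrum (eigenvalues with algebraic multiplicity) of an entrywise nonnegative $n\times n$ matrix. A Jordan canonical form allowed by $\Lambda$ is a Jordan matrix with spectrum $\Lambda$ that is the Jordan canonical form of some real matrix (i.e. the blocks for non-real eigenvalues occur in conjugate pairs of equal sizes). $\Lambda$ is universally realizable if for every Jordan canonical form $\mathbf{J}$ allowed by $\Lambda$ there is an entrywise nonnegative $n\times n$ matrix with Jordan canonical form $\mathbf{J}$ (up to permutation of blocks). For a list $\Gamma$, $s_1(\Gamma)$ denotes the sum of its elements. A companion matrix is the matrix of a monic polynomial $x^m+b_1x^{m-1}+\cdots+b_m$ with ones on the subdiagonal, last column $(-b_m,-b_{m-1},\ldots,-b_1)^T$, and zeros elsewhere. A positive column is a column all of whose entries are positive; diagonalizable means diagonalizable over $\mathbb{C}$. *)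

(* Defs.v *)
From HB Require Import structures.
From mathcomp Require Import all_boot all_order all_algebra.
From mathcomp Require Import reals.
From mathcomp Require Export complex.

Set Implicit Arguments.
Unset Strict Implicit.
Unset Printing Implicit Defensive.

Import Order.TTheory GRing.Theory Num.Theory.
Local Open Scope ring_scope.

(* Lists (multisets) of complex numbers are sequences, compared with perm_eq. *)

Section Definitions.
Variable R : realType.

Definition s1 (G : seq R[i]) : R[i] := \sum_(z <- G) z.

(* The equation forces size G = n, since a characteristic polynomial of
   an n x n matrix has degree n. *)
Definition has_spectrum n (A : 'M[R[i]]_n) (G : seq R[i]) : Prop :=
  char_poly A = \prod_(z <- G) ('X - z%:P).

Definition complexify m n (A : 'M[R]_(m, n)) : 'M[R[i]]_(m, n) :=
  map_mx (real_complex R) A.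

Definition nonnegative_mx m n (A : 'M[R]_(m, n)) : Prop :=
  forall i j, 0 <= A i j.

Definition has_positive_column m n (A : 'M[R]_(m, n)) : Prop :=
  exists j, forall i, 0 < A i j.

Definition realizable (G : seq R[i]) : Prop :=
  exists A : 'M[R]_(size G), nonnegative_mx A /\ has_spectrum (complexify A) G.

Definition jordan_block n (mu : R[i]) : 'M[R[i]]_n :=
  \matrix_(i, j) (mu *+ (i == j) + (i.+1 == j :> nat)%:R).

Definition jordan_mx k (p : 'I_k -> nat) (mu : 'I_k -> R[i]) :
    'M[R[i]]_(\sum_(i < k) p i) :=
  \mxdiag_(i < k) jordan_block (p i) (mu i).

Definition has_jordan_form k (p : 'I_k -> nat) (mu : 'I_k -> R[i])
    (A : 'M[R]_(\sum_(i < k) p i)) : Prop :=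
  simmx_in unitmx (complexify A) (jordan_mx p mu).
Arguments has_jordan_form {k} p mu A.

Definition allowed_jordan_form (G : seq R[i]) k
    (p : 'I_k -> nat) (mu : 'I_k -> R[i]) : Prop :=
  [/\ forall i, (0 < p i)%N,
      has_spectrum (jordan_mx p mu) G
    & exists M, has_jordan_form p mu M].

Definition universally_realizable (G : seq R[i]) : Prop :=
  forall k (p : 'I_k -> nat) (mu : 'I_k -> R[i]),
    allowed_jordan_form G p mu ->
    exists A, nonnegative_mx A /\ has_jordan_form p mu A.

(* companionmx puts the coefficients in the last row and the ones above the
   diagonal; the convention here is its transpose, with last column
   (- p`_0, ..., - p`_(m-1))^T and ones below the diagonal. *)
Definition companion_column (p : {poly R}) : 'M[R]_((size p).-1) :=
  (companionmx p)^T.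

Definition diagonalizable_companion_spectrum (G : seq R[i]) : Prop :=
  exists2 p : {poly R}, p \is monic &
    let A := companion_column p in
    [/\ nonnegative_mx A, has_positive_column A,
        diagonalizable (complexify A) & has_spectrum (complexify A) G].

(* Indices start at 0: auxiliary_list Ls k is Gamma_(k+1), and the k-th entry
   of Ls is Lambda_(k+1). *)
Fixpoint auxiliary_list (Ls : seq (seq R[i])) (k : nat) : seq R[i] :=
  if k is k'.+1 then s1 (auxiliary_list Ls k') :: nth [::] Ls k
  else nth [::] Ls 0.

End Definitions.

(* Main.v *)
Require Import Defs.
From mathcomp Require Import all_boot all_order all_algebra.
From mathcomp Require Import fingroup perm.
From mathcomp Require Import reals.

Set Implicit Arguments.
Unset Strict Implicit.
Unset Printing Implicit Defensive.

Import Order.TTheory GRing.Theory Num.Theory.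
Local Open Scope ring_scope.

(** A list is universally realizable as soon as it is the spectrum of an
    entrywise positive matrix A that is diagonalizable over the complex numbers:
    the semisimple part S of a real matrix M with the required Jordan form is
    real, and A and S are diagonalizable with the same spectrum, so A is
    conjugate to S by a real matrix; the same conjugation turns a small
    multiple of the nilpotent part M - S into a perturbation of A which
    preserves positivity and produces the required Jordan form
    ([positive_diagonalizable_universally_realizable]).

    Positivity can be weakened to nonnegativity with a positive column, provided
    that A has a positive eigenvector w for a simple eigenvalue. Adding to A a
    rank one matrix w q with q w = 0 changes neither the spectrum nor the
    diagonalizability; take the entries of q small and positive except in the
    positive column, where the negative entry that q w = 0 forces is absorbed
    ([positive_column_universally_realizable]).

    It remains to build such an A with spectrum Lambda. The diagonal of a
    companion matrix vanishes except in its last column, where it carries the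
    trace. Hence the companion matrix B of the next auxiliary list, whose
    Perron eigenvalue is this trace c, can replace the 1 x 1 block c. If w and u
    are right and left eigenvectors of B for c, with u w = 1, then

      [c  b]              [B    w b]
      [a  D]   becomes    [a u  D  ]

    On the image of diag(w, 1) the new matrix acts as the old one, and on the
    kernel of u, extended by 0, it acts as B; so an eigenbasis of the new matrix
    is made of one of the old matrix and of the eigenvectors of B for its
    eigenvalues but c ([glue_diagonalized]). For a companion matrix with positive
    last column, u consists of the powers of c and w is explicit, so that both
    are positive; a diagonalizable companion matrix has distinct eigenvalues, so
    that the Vandermonde matrix diagonalizes it ([companion_perron_block]). The
    new matrix keeps a positive column, a positive eigenvector for lambda_1, and
    the trace of B as the diagonal entry in its positive column, which allows
    the next step ([perron_diagonalization_glue]). Finally, lambda_1 is simple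
    in Lambda because the other eigenvalues have nonpositive real part. *)

(** * Eigenbases and characteristic polynomials *)

Section Eigenbases.
Variable F : fieldType.

Lemma char_poly_trmx n (A : 'M[F]_n) : char_poly A^T = char_poly A.
Proof.
rewrite /char_poly -det_tr; congr (\det _).
by rewrite /char_poly_mx linearB /= tr_scalar_mx map_trmx trmxK.
Qed.

Lemma intertwined_char_poly n (A B P : 'M[F]_n) : P \in unitmx ->
  P *m A = B *m P -> char_poly A = char_poly B.
Proof.
move=> Pu PA; pose Q : 'M[{poly F}]_n := map_mx polyC P.
have detQ : \det Q != 0.
  by rewrite /Q det_map_mx polyC_eq0 -unitfE -unitmxE.
apply: (mulfI detQ); rewrite [RHS]mulrC -!det_mulmx; congr (\det _).
rewrite /char_poly_mx mulmxBr mulmxBl -!map_mxM PA; congr (_ - _).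
by rewrite mul_mx_scalar mul_scalar_mx.
Qed.

Lemma rV_perm_eq_roots n (d e : 'rV[F]_n) :
    \prod_i ('X - (d 0 i)%:P) = \prod_i ('X - (e 0 i)%:P) ->
  exists s : 'S_n, forall i, d 0 i = e 0 (s i).
Proof.
move=> eq_prod.
have /tuple_permP[s eq_de] :
    perm_eq [tuple d 0 i | i < n] [tuple e 0 i | i < n].
  by apply: prod_XsubC_eq; rewrite !big_map -enumT !big_enum.
exists s => i; have /(congr1 (fun t => tnth t i)) := val_inj eq_de.
by rewrite !tnth_mktuple.
Qed.

Lemma diag_mx_same_char_poly n (d e : 'rV[F]_n) :
    char_poly (diag_mx d) = char_poly (diag_mx e) ->
  exists2 P, P \in unitmx & P *m diag_mx e = diag_mx d *m P.
Proof.
have cp (f : 'rV[F]_n) : char_poly (diag_mx f) = \prod_i ('X - (f 0 i)%:P).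
  rewrite char_poly_trig ?diag_mx_is_trig //.
  by apply: eq_bigr => i _; rewrite mxE eqxx.
rewrite !cp => /rV_perm_eq_roots[s ds].
exists (perm_mx s); first exact: unitmx_perm.
apply/matrixP=> i j; rewrite mul_diag_mx mul_mx_diag !mxE ds mulrC.
by case: eqVneq => [->|]; rewrite // !mulr0.
Qed.

(** The eigenbasis is allowed to be rectangular, with an explicit inverse: its
    size is then not tied to that of the matrix, and gluing two eigenbases needs
    no cast. The two inverse equations force n = k. *)
Definition diagonalized_by n k (A : 'M[F]_n) (P : 'M[F]_(n, k)) Q d : Prop :=
  [/\ P *m Q = 1%:M, Q *m P = 1%:M & A *m P = P *m diag_mx d].

End Eigenbases.

Lemma prod_XsubC_row_mx (F : comNzRingType) m n (d : 'rV[F]_m) (e : 'rV[F]_n) :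
  \prod_i ('X - (row_mx d e 0 i)%:P) =
  \prod_i ('X - (d 0 i)%:P) * \prod_i ('X - (e 0 i)%:P).
Proof.
rewrite big_split_ord; congr (_ * _); apply: eq_bigr => i _.
  by rewrite row_mxEl.
by rewrite row_mxEr.
Qed.

(** * Bidiagonal matrices in the shape of a Jordan matrix *)

Section JordanLike.
Variable F : fieldType.

(** N lives on the superdiagonal and commutes with the diagonal matrix of d, so
    that diag_mx d and N are the semisimple and the nilpotent part of their sum.
    A Jordan matrix has this shape, and no reference to its blocks remains. *)
Definition jordan_like n (d : 'rV[F]_n) (N : 'M[F]_n) : Prop :=
  forall i j, N i j != 0 -> j = i.+1 :> nat /\ d 0 i = d 0 j.

(** Semisimple parts are intertwined by whatever intertwines the sums. The
    entry of the equation at (i, j) expresses (d_i - e_j) X_ij by the entries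
    X_(i+1)j and X_i(j-1), which occur only if d_(i+1) = d_i, respectively
    e_(j-1) = e_j. So X_ij vanishes when d_i and e_j differ, by induction on the
    distance of (i, j) to the lower left corner. *)
Lemma jordan_like_intertwine n m (d : 'rV[F]_n) (e : 'rV[F]_m) N L
    (X : 'M[F]_(n, m)) :
  jordan_like d N -> jordan_like e L ->
  (diag_mx d + N) *m X = X *m (diag_mx e + L) ->
  diag_mx d *m X = X *m diag_mx e.
Proof.
move=> JN JL eqX.
have X0 i j : d 0 i != e 0 j -> X i j = 0.
  have [k] := ubnP (n - i + j)%N; elim: k i j => // k IHk i j lek dNe.
  have NX0 : (N *m X) i j = 0.
    rewrite mxE big1 // => l _.
    have [->|/JN[Dl del]] := eqVneq (N i l) 0; first by rewrite mul0r.
    rewrite IHk ?mulr0 -?del // Dl; have := ltn_ord l; rewrite Dl => ltin.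
    by move: lek; rewrite -(subnSK (ltnW ltin)) addSn ltnS.
  have XL0 : (X *m L) i j = 0.
    rewrite mxE big1 // => l _.
    have [->|/JL[Dj edl]] := eqVneq (L l j) 0; first by rewrite mulr0.
    by rewrite IHk ?mul0r ?edl // -ltnS -addnS -Dj.
  have /matrixP/(_ i j) := eqX.
  rewrite mulmxDl mulmxDr mxE [RHS]mxE NX0 XL0 !addr0.
  rewrite mul_diag_mx mul_mx_diag !mxE [RHS]mulrC => /eqP.
  by rewrite -subr_eq0 -mulrBl mulf_eq0 subr_eq0 (negPf dNe) => /eqP.
apply/matrixP=> i j; rewrite mul_diag_mx mul_mx_diag !mxE mulrC.
by have [->//|/X0->] := eqVneq (d 0 i) (e 0 j); rewrite !mul0r.
Qed.

(** Conjugation by the diagonal matrix of the powers of a multiplies the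
    superdiagonal by a. *)
Lemma jordan_like_scale n (d : 'rV[F]_n) N (a : F) :
  jordan_like d N -> a != 0 ->
  exists2 E : 'M[F]_n, E \in unitmx &
    E *m (diag_mx d + a *: N) = (diag_mx d + N) *m E.
Proof.
move=> JN a_neq0; exists (diag_mx (\row_i a ^+ i)).
  rewrite unitmxE det_diag rpred_prod // => i _.
  by rewrite mxE unitfE expf_neq0.
rewrite mulmxDr mulmxDl diag_mxC; congr (_ + _).
apply/matrixP=> i j; rewrite mul_diag_mx mul_mx_diag !mxE.
have [->|/JN[-> _]] := eqVneq (N i j) 0; first by rewrite !(mulr0, mul0r).
by rewrite exprSr mulrA mulrC.
Qed.

Lemma jordan_like_char_poly n (d : 'rV[F]_n) N :
  jordan_like d N -> char_poly (diag_mx d + N) = \prod_i ('X - (d 0 i)%:P).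
Proof.
move=> JN; have N0 (i j : 'I_n) : (j <= i)%N -> N i j = 0.
  by move=> le_ji; apply/eqP; apply: contraTT le_ji => /JN[-> _]; rewrite ltnn.
have trigJ : is_trig_mx (diag_mx d + N)^T.
  apply/is_trig_mxP=> i j lt_ij; rewrite !mxE N0 ?(ltnW lt_ij) //.
  by rewrite -val_eqE gtn_eqF ?addr0.
rewrite -char_poly_trmx char_poly_trig //; apply: eq_bigr => i _.
by rewrite !mxE eqxx N0 ?addr0.
Qed.

End JordanLike.

Section JordanMatrix.
Variable R : realType.
Local Notation C := R[i].

Lemma jordan_mx_split k (p : 'I_k -> nat) (mu : 'I_k -> C) :
  exists d N, jordan_mx p mu = diag_mx d + N /\ jordan_like d N.
Proof.
exists (\row_s mu (tagnat.sig1 s)).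
exists (\matrix_(s, s')
  ((tagnat.sig1 s == tagnat.sig1 s') && (s.+1 == s' :> nat))%:R).
split; last first.
  move=> s s'; rewrite !mxE.
  by case: andP => [[/eqP-> /eqP->]//|_]; rewrite eqxx.
apply/matrixP=> s s'; rewrite !mxE.
have rs := tagnat.rect s; have rs' := tagnat.rect s'.
have [-> | ne_ss] := eqVneq s s'.
  by rewrite eqxx conform_mx_id !mxE !eqxx !gtn_eqF.
move: (tagnat.sig1 s) (tagnat.sig2 s) (tagnat.sig1 s') (tagnat.sig2 s') rs rs'.
move=> i a j b rs rs'; have [eq_ij | _] := eqVneq i j; last by rewrite mxE addr0.
subst j; rewrite conform_mx_id mxE rs rs' -addnS eqn_add2l.
have [eq_ab|//] := eqVneq a b.
by move: ne_ss; rewrite -val_eqE /= rs rs' eq_ab eqxx.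
Qed.

End JordanMatrix.

(** * Descent from complex to real matrices *)

Section RealDescent.
Variable R : realType.
Local Notation C := R[i].
Local Notation rc := (real_complex R).

Lemma complexifyM m n p (A : 'M[R]_(m, n)) (B : 'M[R]_(n, p)) :
  complexify (A *m B) = complexify A *m complexify B.
Proof. exact: map_mxM. Qed.

Lemma complexifyZ m n (a : R) (A : 'M[R]_(m, n)) :
  complexify (a *: A) = rc a *: complexify A.
Proof. exact: map_mxZ. Qed.

Lemma complexify_unit n (A : 'M[R]_n) :
  (complexify A \in unitmx) = (A \in unitmx).
Proof. exact: map_unitmx. Qed.

Lemma complexify_inv n (A : 'M[R]_n) :
  complexify (invmx A) = invmx (complexify A).
Proof. exact: map_invmx. Qed.

Lemma complexify_block m1 m2 n1 n2 (A : 'M[R]_(m1, n1)) (B : 'M_(m1, n2))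
    (D : 'M_(m2, n1)) E :
  complexify (block_mx A B D E) =
  block_mx (complexify A) (complexify B) (complexify D) (complexify E).
Proof. exact: map_block_mx. Qed.

Lemma conj_invariant_real m n (A : 'M[C]_(m, n)) :
  map_mx (@conjc R) A = A -> complexify (map_mx (@complex.Re R) A) = A.
Proof.
move/matrixP=> barA; apply/matrixP=> i j; have := barA i j; rewrite !mxE.
case: (A i j) => a b /= /eqP; rewrite eq_complex /= eqxx eq_sym -addr_eq0.
by rewrite -mulr2n mulrn_eq0 /= => /eqP->.
Qed.

(** The real and imaginary parts X and Y of W intertwine A and S as well. The
    polynomial det (X + t Y) does not vanish at the imaginary unit, so it does
    not vanish at some real t. *)
Lemma real_intertwiner n (A S : 'M[R]_n) (W : 'M[C]_n) :
    W \in unitmx -> complexify A *m W = W *m complexify S ->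
  exists2 T : 'M[R]_n, T \in unitmx & A *m T = T *m S.
Proof.
move=> Wu eqW.
pose X := \matrix_(i, j) complex.Re (W i j).
pose Y := \matrix_(i, j) complex.Im (W i j).
have defW : W = complexify X + 'i%C *: complexify Y.
  by apply/matrixP=> i j; rewrite !mxE -complexE.
have [AX AY] : A *m X = X *m S /\ A *m Y = Y *m S.
  move: eqW; rewrite defW mulmxDr mulmxDl -scalemxAr -scalemxAl -!complexifyM.
  move/matrixP=> eqW; split; apply/matrixP=> i j; have := eqW i j;
    move: (A *m X) (A *m Y) (X *m S) (Y *m S) => A1 A2 A3 A4;
    rewrite !mxE => /eqP;
    rewrite eq_complex /= !mul0r !mul1r subr0 !addr0 !add0r;
    by move=> /andP[/eqP + /eqP].
pose M := map_mx polyC X + 'X *: map_mx polyC Y.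
have evR (t : R) : (\det M).[t] = \det (X + t *: Y).
  rewrite -[LHS]/(horner_eval t (\det M)) -det_map_mx; congr (\det _).
  by apply/matrixP=> i j; rewrite !mxE /= /horner_eval !hornerE.
(* Evaluation of M at the imaginary unit gives W. *)
have detM_neq0 : \det M != 0.
  apply/eqP=> M0; move: Wu; rewrite unitmxE unitfE => /eqP[].
  have /(congr1 (horner_eval ('i%C : C) \o map_poly rc)) := M0.
  rewrite /= -!det_map_mx !rmorph0 => <-; congr (\det _).
  apply/matrixP=> i j; rewrite defW !mxE /= /horner_eval.
  by rewrite rmorphD rmorphM /= map_polyX !map_polyC !hornerE.
have [t /negP Mt] : exists t : R, ~ root (\det M) t.
  pose rs : seq R := [seq k%:R | k <- iota 0 (size (\det M))].
  have /allPn[t _ Mt] : ~~ all (root (\det M)) rs.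
    apply: contra detM_neq0 => all_rs; apply/eqP/(roots_geq_poly_eq0 all_rs).
      by rewrite map_inj_uniq ?iota_uniq // => a b /eqP; rewrite eqr_nat => /eqP.
    by rewrite size_map size_iota.
  by exists t; apply/negP.
exists (X + t *: Y).
  2: by rewrite mulmxDr mulmxDl AX -scalemxAr -scalemxAl AY.
by rewrite unitmxE unitfE -evR.
Qed.

(** S is the semisimple part of M. The complex conjugate of S is the semisimple
    part of the conjugate of M, that is of M, and semisimple parts are unique by
    [jordan_like_intertwine]; hence S is real. *)
Lemma real_semisimple_part n (M : 'M[R]_n) (P : 'M[C]_n) d N :
    jordan_like d N -> P \in unitmx ->
    P *m complexify M = (diag_mx d + N) *m P ->
  exists S : 'M[R]_n, P *m complexify S = diag_mx d *m P.
Proof.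
move=> JN Pu PM.
pose bar m (A : 'M[C]_(m, n)) := map_mx (@conjc R) A.
have bar_real m (A : 'M[R]_(m, n)) : bar m (complexify A) = complexify A.
  by apply/matrixP=> i j; rewrite !mxE conjc_real.
have JbN : jordan_like (bar _ d) (bar _ N).
  move=> i j; rewrite !mxE conjc_eq0 => /JN[-> ->].
  by split.
have bPu : bar _ P \in unitmx by rewrite map_unitmx.
have bPM : bar _ P *m complexify M = (diag_mx (bar _ d) + bar _ N) *m bar _ P.
  rewrite -[complexify M]bar_real -map_mxM PM map_mxM /=; congr (_ *m _).
  by rewrite map_mxD map_diag_mx.
pose Sc := invmx P *m diag_mx d *m P.
have barS : bar _ Sc = Sc.
  have /(jordan_like_intertwine JN JbN) :
      (diag_mx d + N) *m (P *m invmx (bar _ P))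
      = (P *m invmx (bar _ P)) *m (diag_mx (bar _ d) + bar _ N).
    rewrite mulmxA -PM -[RHS](mulmxK bPu) -[_ *m bar _ P]mulmxA -bPM.
    by rewrite mulmxA mulmxKV.
  rewrite !mulmxA => /(congr1 (fun Z => invmx P *m Z *m bar _ P)) eqD.
  have -> : bar _ Sc = invmx (bar _ P) *m diag_mx (bar _ d) *m bar _ P.
    by rewrite /bar !map_mxM /= map_diag_mx map_invmx.
  move: eqD; rewrite !mulmxA mulmxKV // mulVmx // mul1mx.
  by move=> <-.
exists (map_mx (@complex.Re R) Sc).
rewrite (conj_invariant_real barS).
by rewrite !mulmxA mulmxV // mul1mx.
Qed.

End RealDescent.

(** * Universal realizability from a positive matrix *)

Section Perturbation.
Variable R : realType.
Local Notation C := R[i].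
Local Notation rc := (real_complex R).

Lemma exists_small (I : finType) (a b : I -> R) : (forall i, 0 < a i) ->
  exists2 e : R, 0 < e & forall i, e * `|b i| < a i.
Proof.
move=> a_gt0; pose s := \sum_i `|b i| / a i.
have t_ge0 i : 0 <= `|b i| / a i by rewrite divr_ge0 // ltW.
have s_ge0 : 0 <= s by rewrite sumr_ge0.
have s1_gt0 : 0 < 1 + s by rewrite ltr_pwDl.
exists (1 + s)^-1; rewrite ?invr_gt0 // => i.
rewrite mulrC ltr_pdivrMr // -ltr_pdivrMl // mulrC.
by rewrite (@le_lt_trans _ _ s) ?ltrDr ?ltr01 // /s (bigD1 i) //= lerDl sumr_ge0.
Qed.

(** The matrix sought is A + e K, where K is the nilpotent part of M carried
    over to A by a real matrix that conjugates the semisimple part of M to A,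
    and e is small enough to keep the entries nonnegative. *)
Lemma positive_diagonalizable_jordan n (A M : 'M[R]_n) (Q P : 'M[C]_n) d N :
    (forall i j, 0 < A i j) -> Q \in unitmx ->
    Q *m complexify A = diag_mx d *m Q ->
    jordan_like d N -> P \in unitmx ->
    P *m complexify M = (diag_mx d + N) *m P ->
  exists2 A', nonnegative_mx A' &
    exists2 P', P' \in unitmx & P' *m complexify A' = (diag_mx d + N) *m P'.
Proof.
move=> A_gt0 Qu QA JN Pu PM.
have [S PS] := real_semisimple_part JN Pu PM.
have [T Tu AT] : exists2 T, T \in unitmx & A *m T = T *m S.
  apply: (@real_intertwiner _ _ _ _ (invmx Q *m P)).
    by rewrite unitmx_mul unitmx_inv Qu.
  rewrite -mulmxA PS mulmxA -[in LHS](mulKmx Qu (complexify A)) QA.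
  by rewrite -!mulmxA mulKVmx.
pose K := T *m (M - S) *m invmx T.
have [e e_gt0 eK] := exists_small (fun ij => K ij.1 ij.2)
  (fun ij : 'I_n * 'I_n => A_gt0 ij.1 ij.2).
have e_neq0 : rc e != 0 by rewrite fmorph_eq0 gt_eqF.
(* Scaling the nilpotent part by e is undone by conjugation with E. *)
have [E Eu EN] := jordan_like_scale JN e_neq0.
exists (A + e *: K).
  move=> i j; rewrite mxE [X in _ + X]mxE -[_ * _]opprK subr_ge0.
  apply: le_trans (ltW (eK (i, j))); rewrite -mulrN.
  by rewrite ler_wpM2l ?(ltW e_gt0) // -normrN ler_norm.
exists (E *m P *m invmx (complexify T)).
  by rewrite !unitmx_mul Eu Pu unitmx_inv complexify_unit.
have defA : A + e *: K = T *m (S + e *: (M - S)) *m invmx T.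
  rewrite mulmxDr mulmxDl -AT mulmxK //; congr (_ + _).
  by rewrite -scalemxAr -scalemxAl.
have PSM : P *m complexify (S + e *: (M - S)) = (diag_mx d + rc e *: N) *m P.
  rewrite /complexify map_mxD map_mxZ map_mxB -!/(complexify _).
  rewrite mulmxDr -scalemxAr mulmxBr PS PM -mulmxBl (addrC (diag_mx d)) addrK.
  by rewrite scalemxAl -mulmxDl.
rewrite defA !complexifyM complexify_inv !mulmxA.
rewrite mulmxKV ?complexify_unit // -[E *m P *m _]mulmxA PSM.
by rewrite !mulmxA EN.
Qed.

Lemma positive_diagonalizable_universally_realizable n k (A : 'M[R]_n)
    (P : 'M[C]_(n, k)) Q d G :
    (forall i j, 0 < A i j) -> diagonalized_by (complexify A) P Q d ->
    \prod_i ('X - (d 0 i)%:P) = \prod_(z <- G) ('X - z%:P) ->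
  universally_realizable G.
Proof.
move=> A_gt0 [PQ QP AP] dG m p mu [_ JG [M [P' P'u /(simmxP P'u) P'M]]].
have eq_kn : k = n.
  by apply/eqP; rewrite eqn_leq (mulmx1_min PQ) (mulmx1_min QP).
have eq_np : n = (\sum_(i < m) p i)%N.
  apply: succn_inj; rewrite -(size_char_poly (jordan_mx p mu)) JG -dG.
  by rewrite size_prod_XsubC /index_enum -enumT size_enum_ord eq_kn.
move: P Q d PQ QP AP dG; rewrite eq_kn => P Q d PQ QP AP dG.
move: A A_gt0 P Q d PQ QP AP dG; rewrite eq_np => A A_gt0 P Q d PQ QP AP dG.
have [e [N [defJ JN]]] := jordan_mx_split p mu.
have [E Eu Ed] : exists2 E, E \in unitmx & E *m diag_mx d = diag_mx e *m E.
  apply: diag_mx_same_char_poly.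
  have J0 (f : 'rV[C]_(\sum_(i < m) p i)) : jordan_like f 0.
    by move=> i j; rewrite mxE eqxx.
  rewrite -[diag_mx d]addr0 -[diag_mx e]addr0 !jordan_like_char_poly //.
  by rewrite dG -JG defJ jordan_like_char_poly.
have Qu : Q \in unitmx by have [] := mulmx1_unit QP.
have QA : Q *m complexify A = diag_mx d *m Q.
  by rewrite -[LHS]mulmx1 -PQ mulmxA -(mulmxA Q) AP mulmxA QP mul1mx.
have [|||A' A'_ge0 [P1 P1u P1A]] :=
    @positive_diagonalizable_jordan _ A M (E *m Q) P' e N A_gt0 _ _ JN P'u.
- by rewrite unitmx_mul Eu.
- by rewrite -mulmxA QA !mulmxA Ed.
- by rewrite P'M defJ.
exists A'; split=> //; exists P1 => //; apply/simmxP => //.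
by rewrite P1A defJ.
Qed.

End Perturbation.

(** * Universal realizability from a positive column *)

(** Brauer's rank one perturbation along an eigenvector, in the case where it
    keeps the spectrum. The eigenvectors for the other eigenvalues are corrected
    by multiples of col 0 P, and the coefficient r_j is the quotient of
    (q P)_j by d_j - d_0. *)
Lemma diagonalized_by_rank_one (F : fieldType) n k (A : 'M[F]_n)
    (P : 'M[F]_(n, k.+1)) Q d (q : 'rV[F]_n) :
    diagonalized_by A P Q d -> q *m col 0 P = 0 ->
    (forall j, j != 0 -> d 0 j != d 0 0) ->
  exists P' Q', diagonalized_by (A + col 0 P *m q) P' Q' d.
Proof.
move=> [PQ QP AP] qw0 d0.
have [x defx] : exists x, x = q *m P by exists (q *m P).
pose r := \row_j if j == 0 then 0 else x 0 j / (d 0 j - d 0 0).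
pose e0 : 'cV[F]_k.+1 := delta_mx 0 0.
have re0 : r *m e0 = 0 by rewrite -colE; apply/colP=> i; rewrite !mxE eqxx.
have er_er : (e0 *m r) *m (e0 *m r) = 0.
  by rewrite mulmxA -(mulmxA e0) re0 mulmx0 mul0mx.
have inv1 : (1%:M + e0 *m r) *m (1%:M - e0 *m r) = 1%:M.
  by rewrite mulmxBr mulmx1 mulmxDl mul1mx er_er addr0 addrK.
exists (P *m (1%:M + e0 *m r)), ((1%:M - e0 *m r) *m Q); split.
- by rewrite mulmxA -(mulmxA P) inv1 mulmx1.
- by rewrite mulmxA -(mulmxA _ Q P) QP mulmx1; apply: mulmx1C.
have xe0 : x *m e0 = 0 by rewrite defx -mulmxA -colE.
have xE : x = r *m diag_mx d - d 0 0 *: r.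
  apply/rowP=> j; rewrite mul_mx_diag !mxE.
  have [-> | j_neq0] := eqVneq j 0.
    have /matrixP/(_ 0 0) := xe0; rewrite -colE !mxE => ->.
    by rewrite mul0r mulr0 subr0.
  by rewrite [d 0 0 * _]mulrC -mulrBr divfK // subr_eq0 d0.
have De0 : diag_mx d *m e0 = d 0 0 *: e0.
  apply/colP=> i; rewrite mul_diag_mx !mxE.
  by have [->//|] := eqVneq i 0; rewrite /= !mulr0.
rewrite colE -/e0 mulmxDl mulmxA AP -!mulmxA -mulmxDr; congr (_ *m _).
rewrite !mulmxDr !mulmxDl !mulmx1 !mul1mx (mulmxA _ e0) De0.
rewrite (mulmxA q) -!defx (mulmxA x) xe0 mul0mx mulmx0 addr0.
rewrite xE mulmxBr -scalemxAl -scalemxAr.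
by rewrite -addrA; congr (_ + _); rewrite addrC subrK mulmxA.
Qed.

Section PositiveColumn.
Variable R : realType.
Local Notation C := R[i].

Lemma positive_column_universally_realizable n k (A : 'M[R]_n.+1)
    (w : 'cV[R]_n.+1) (P : 'M[C]_(n.+1, k.+1)) Q d G :
    nonnegative_mx A -> (forall i, 0 < A i 0) -> (forall i, 0 < w i 0) ->
    diagonalized_by (complexify A) P Q d -> col 0 P = complexify w ->
    (forall j, j != 0 -> d 0 j != d 0 0) ->
    \prod_i ('X - (d 0 i)%:P) = \prod_(z <- G) ('X - z%:P) ->
  universally_realizable G.
Proof.
move=> A_ge0 A0_gt0 w_gt0 dA colP d0 dG.
pose s := (\sum_(j | j != 0) w j 0) / w 0 0.
have [e e_gt0 e_small] := exists_small (fun i => w i 0 * s) A0_gt0.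
(* The entry at 0 is the one that makes q orthogonal to w. *)
pose q : 'rV[R]_n.+1 := \row_j if j == 0 then - (e * s) else e.
have qw0 : q *m w = 0.
  apply/rowP=> i; rewrite !mxE ord1 (bigD1 0) //= !mxE eqxx.
  rewrite (eq_bigr (fun j => e * w j 0)) => [|j /negPf j0].
    2: by rewrite mxE j0.
  by rewrite -mulr_sumr mulNr -mulrA divfK ?addNr // gt_eqF.
have Aq_gt0 i j : 0 < (A + w *m q) i j.
  rewrite mxE [X in _ + X]mxE big_ord1 mxE.
  have [->|_] := eqVneq j 0; last by rewrite ltr_wpDl // mulr_gt0.
  rewrite mulrN subr_gt0 mulrCA (le_lt_trans _ (e_small i)) //.
  by rewrite ler_wpM2l ?ler_norm ?ltW.
have [||P' [Q' dAq]] :=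
    @diagonalized_by_rank_one _ _ _ _ _ _ _ (complexify q) dA.
- by rewrite colP -complexifyM qw0; apply: map_mx0.
- by [].
move: dAq; rewrite colP -complexifyM -[complexify A + _]map_mxD => dAq.
exact: positive_diagonalizable_universally_realizable Aq_gt0 dAq dG.
Qed.

End PositiveColumn.

(** * Gluing along a diagonal entry *)

(** With E = diag(w, 1) and E' = diag(u, 1), the new matrix C satisfies
    C E = E A and E' E = 1, while E E' and the projection along w onto the
    kernel of u add up to the identity. *)
Lemma glue_diagonalized (F : fieldType) m r n p (c : F) (b : 'rV_m) (a : 'cV_m)
    (A11 : 'M_m) (PA : 'M_(1 + m, r)) QA dA (B : 'M_n) (w : 'cV_n) (u : 'rV_n)
    (Z : 'M_(n, p)) Y dB :
    diagonalized_by (block_mx c%:M b a A11) PA QA dA ->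
    diagonalized_by B (row_mx w Z) (col_mx u Y) (row_mx c%:M dB) ->
  diagonalized_by (block_mx B (w *m b) (a *m u) A11)
    (row_mx (block_mx w 0 0 1%:M *m PA) (col_mx Z 0))
    (col_mx (QA *m block_mx u 0 0 1%:M) (row_mx Y 0)) (row_mx dA dB).
Proof.
move=> [PQA QPA AP] [PQB QPB BP].
have wuZY : w *m u + Z *m Y = 1%:M by rewrite -mul_row_col.
have [uw uZ Yw YZ] : [/\ u *m w = 1%:M, u *m Z = 0, Y *m w = 0 & Y *m Z = 1%:M].
  by move: QPB; rewrite mul_col_row scalar_mx_block => /eq_block_mx[].
have [Bw BZ] : B *m w = w *m c%:M /\ B *m Z = Z *m diag_mx dB.
  move: BP; rewrite mul_mx_row diag_mx_row mul_row_block !mulmx0 addr0 add0r.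
  move=> /eq_row_mx[-> ->]; split=> //; congr (_ *m _).
  by apply/matrixP=> i j; rewrite !mxE !ord1.
pose E : 'M_(n + m, 1 + m) := block_mx w 0 0 1%:M.
pose E' : 'M_(1 + m, n + m) := block_mx u 0 0 1%:M.
have E'E : E' *m E = 1%:M.
  rewrite mulmx_block !(mulmx0, mul0mx, mulmx1) uw !addr0 !add0r.
  by rewrite -scalar_mx_block.
have CE : block_mx B (w *m b) (a *m u) A11 *m E = E *m block_mx c%:M b a A11.
  rewrite !mulmx_block !(mulmx0, mul0mx, mulmx1, mul1mx) !addr0 !add0r.
  by rewrite Bw -mulmxA uw mulmx1.
split.
- rewrite mul_row_col mul_col_row mulmxA -(mulmxA _ PA) PQA mulmx1.
  rewrite mulmx_block add_block_mx !(mulmx0, mul0mx, mulmx1) !addr0 !add0r.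
  by rewrite wuZY -scalar_mx_block.
- rewrite mul_col_row mulmxA -(mulmxA QA) E'E mulmx1 QPA -mulmxA.
  rewrite mul_block_col mulmxA mul_row_block mul_row_col.
  rewrite !(mulmx0, mul0mx, mulmx1) !addr0 uZ Yw YZ col_mx0 mulmx0.
  by rewrite row_mx0 mul0mx -scalar_mx_block.
rewrite mul_mx_row mulmxA CE -!mulmxA AP diag_mx_row mul_row_block !mulmx0.
rewrite addr0 add0r mulmxA; congr row_mx.
by rewrite mul_block_col !mulmx0 !addr0 -mulmxA uZ mulmx0 BZ mul_col_mx mul0mx.
Qed.

Section Glue.
Variable R : realType.
Local Notation C := R[i].
Local Notation rc := (real_complex R).

(** The invariant of the gluing process: a nonnegative matrix with spectrum G,
    whose column 0 is positive with diagonal entry c, and which has a positive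
    eigenvector for lam as the first vector of an eigenbasis. The entry c is the
    one that the next block replaces. *)
Variant perron_diagonalization (lam c : C) (G : seq C) : Prop :=
  PerronDiagonalization n k (A : 'M[R]_n.+1) (w : 'cV[R]_n.+1)
      (P : 'M[C]_(n.+1, k.+1)) Q d of
    nonnegative_mx A & forall i, 0 < A i 0 & rc (A 0 0) = c &
    forall i, 0 < w i 0 & diagonalized_by (complexify A) P Q d &
    col 0 P = complexify w & d 0 0 = lam &
    \prod_i ('X - (d 0 i)%:P) = \prod_(z <- G) ('X - z%:P).

(** A block that can replace a diagonal entry lam: a matrix with spectrum
    lam :: s, normalized positive right and left eigenvectors for lam, and an
    eigenbasis containing them. *)
Variant perron_block (lam c : C) (s : seq C) : Prop :=
  PerronBlock n p (B : 'M[R]_n.+1) (w : 'cV[R]_n.+1) (u : 'rV[R]_n.+1)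
      (Z : 'M[C]_(n.+1, p)) Y d of
    nonnegative_mx B & forall i, 0 < B i 0 & rc (B 0 0) = c &
    forall i, 0 < w i 0 & forall j, 0 < u 0 j &
    diagonalized_by (complexify B) (row_mx (complexify w) Z)
      (col_mx (complexify u) Y) (row_mx lam%:M d) &
    \prod_i ('X - (d 0 i)%:P) = \prod_(z <- s) ('X - z%:P).

Lemma perron_block_diagonalization lam c s :
  perron_block lam c s -> perron_diagonalization lam c (lam :: s).
Proof.
case=> n p B w u Z Y d B_ge0 B0 Bc w_gt0 u_gt0 dB ds.
apply: PerronDiagonalization B_ge0 B0 Bc w_gt0 dB _ _ _.
- transitivity (col (lshift p 0) (row_mx (complexify w) Z)).
    by congr col; apply: val_inj.
  by rewrite colKl; apply/colP=> i; rewrite !mxE.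
- transitivity ((row_mx lam%:M d : 'rV_(1 + p)) 0 (lshift p 0)).
    by congr (fun_of_matrix _ _ _); apply: val_inj.
  by rewrite row_mxEl mxE eqxx.
apply: etrans (prod_XsubC_row_mx lam%:M d) _.
by rewrite big_cons -ds big_ord1 mxE.
Qed.

Lemma perron_diagonalization_glue lam c c' G s :
  perron_diagonalization lam c G -> perron_block c c' s ->
  perron_diagonalization lam c' (G ++ s).
Proof.
case=> m k A w P Q d A_ge0 A0 Ac w_gt0 dA colP dlam dG.
case=> n p B x u Z Y e B_ge0 B0 B0c x_gt0 u_gt0 dB ds.
pose b : 'M_(1, m) := ursubmx (A : 'M_(1 + m)).
pose a : 'M_(m, 1) := dlsubmx (A : 'M_(1 + m)).
pose D : 'M_(m, m) := drsubmx (A : 'M_(1 + m)).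
have a_gt0 i : 0 < a i 0.
  rewrite !mxE; have := A0 (rshift 1 i).
  by congr (0 < A _ _); apply: val_inj.
have defA : complexify A =
    block_mx c%:M (complexify b) (complexify a) (complexify D).
  apply: etrans (congr1 (@complexify R _ _) (esym (@submxK _ 1 m 1 m A))) _.
  rewrite complexify_block; congr block_mx.
  apply/matrixP=> i j; rewrite !ord1 !mxE -Ac eqxx.
  by congr (rc (A _ _)); apply: val_inj.
have := dA; rewrite defA => dA'.
have dAB := glue_diagonalized dA' dB.
pose AB : 'M[R]_(n.+1 + m) := block_mx B (x *m b) (a *m u) D.
pose v : 'cV[R]_(n.+1 + m) := block_mx x 0 0 1%:M *m w.
have Cv : complexify v = block_mx (complexify x) 0 0 1%:M *m complexify w.
  rewrite /v complexifyM complexify_block; congr (block_mx _ _ _ _ *m _);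
    by [apply: map_mx0 | apply: map_mx1].
have CAB : complexify AB =
    block_mx (complexify B) (complexify x *m complexify b)
      (complexify a *m complexify u) (complexify D).
  by rewrite complexify_block !complexifyM.
rewrite -CAB in dAB.
have AB_ge0 : nonnegative_mx AB.
  move=> i j; rewrite -(splitK i) -(splitK j).
  case: (split i) (split j) => [i'|i'] [j'|j'] /=.
  - by rewrite block_mxEul.
  - by rewrite block_mxEur mxE big_ord1 mulr_ge0 ?(ltW (x_gt0 _)) // !mxE.
  - by rewrite block_mxEdl mxE big_ord1 mulr_ge0 ?(ltW (u_gt0 _)) ?ltW.
  by rewrite block_mxEdr !mxE.
have AB_gt0 i : 0 < AB i (lshift m 0).
  rewrite -(splitK i); case: (split i) => i' /=; first by rewrite block_mxEul.
  by rewrite block_mxEdl mxE big_ord1 mulr_gt0.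
have v_gt0 i : 0 < v i 0.
  rewrite /v -[w](@vsubmxK _ 1 m 1) mul_block_col !mul0mx mul1mx addr0 add0r.
  rewrite -(splitK i); case: (split i) => i' /=.
    by rewrite col_mxEu mxE big_ord1 mulr_gt0 // mxE.
  by rewrite col_mxEd mxE.
apply: (@PerronDiagonalization _ _ _ (n + m) (k + p) AB v _ _ _
  AB_ge0 _ _ v_gt0 dAB).
- by move=> i; have := AB_gt0 i; congr (0 < AB _ _); apply: val_inj.
- rewrite -B0c; congr (rc _).
  rewrite -[RHS](@block_mxEul _ _ _ _ _ B (x *m b) (a *m u) D).
  by congr (AB _ _); apply: val_inj.
- transitivity (col (lshift p 0)
      (row_mx (block_mx (complexify x) 0 0 1%:M *m P) (col_mx Z 0))).
    by congr col; apply: val_inj.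
  by rewrite colKl Cv -colP !colE mulmxA.
- transitivity (row_mx d e 0 (lshift p 0)); last by rewrite row_mxEl.
  by congr (fun_of_matrix _ _ _); apply: val_inj.
by apply: etrans (prod_XsubC_row_mx d e) _; rewrite big_cat dG ds.
Qed.

Lemma perron_diagonalization_gt0 (lam c : C) G :
  perron_diagonalization lam c G -> 0 < c.
Proof. by case=> n k A w P Q d _ A0_gt0 <- *; rewrite ltcR. Qed.

(** The sign conditions make lam simple: the real part of lam is positive, that
    of the other eigenvalues is not. *)
Lemma perron_diagonalization_universally_realizable (lam c : C) s G :
    perron_diagonalization lam c G -> perm_eq (lam :: s) G ->
    0 < lam -> (forall z, z \in s -> complex.Re z <= 0) ->
  universally_realizable (lam :: s).
Proof.
case=> n k A w P Q d A_ge0 A0_gt0 _ w_gt0 dA colP d0 dG eqG.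
rewrite ltcE => /andP[_ Re_lam] Re_s.
have ds : \prod_i ('X - (d 0 i)%:P) = \prod_(z <- lam :: s) ('X - z%:P).
  by rewrite dG (perm_big _ eqG).
apply: (positive_column_universally_realizable A_ge0 A0_gt0 w_gt0 dA colP _ ds).
move=> j j_neq0.
have dj_s : d 0 j \in s.
  rewrite -root_prod_XsubC; move: ds; rewrite (bigD1 0) //= big_cons d0.
  move/(mulfI (negbT (polyXsubC_eq0 lam))) <-.
  by rewrite (bigD1 j) //= rootM root_XsubC eqxx.
by apply: contraTneq Re_lam; rewrite d0 => <-; rewrite -leNgt Re_s.
Qed.

End Glue.

(** * Companion matrices *)

Section Companion.
Variable F : fieldType.

(** Each left eigenvector is determined by its first entry: it is a multiple of
    the vector of powers of its eigenvalue. So the Vandermonde determinant of the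
    eigenvalues divides the determinant of the eigenbasis. In particular, a
    diagonalizable companion matrix has distinct eigenvalues. *)
Lemma unit_subdiagonal_diagonal_uniq n (A P : 'M[F]_n) e :
    (forall i j : 'I_n, (j.+1 < n)%N -> A i j = (i == j.+1 :> nat)%:R) ->
    P \in unitmx -> P *m A = diag_mx e *m P ->
  injective (e 0).
Proof.
case: n => [|n] in A P e * => subA Pu PA; first by case.
have Pij i j : P i j = P i 0 * e 0 i ^+ j.
  case: j => j; elim: j => [|j IHj] ltjn.
    by rewrite mulr1; congr (P _ _); apply: val_inj.
  have ltjn' := ltnW ltjn.
  have /matrixP/(_ i (Ordinal ltjn')) := PA.
  rewrite mul_diag_mx !mxE (bigD1 (Ordinal ltjn)) //= subA //= eqxx mulr1.
  rewrite big1 ?addr0 => [->|k ne_k]; last first.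
    by rewrite subA // (negPf (ne_k : k != j.+1 :> nat)) mulr0.
  by rewrite IHj /= exprS mulrCA.
have defP : P = diag_mx (\row_i P i 0) *m (Vandermonde n.+1 e)^T.
  by apply/matrixP=> i j; rewrite mul_diag_mx !mxE Pij.
have : \det (Vandermonde n.+1 e) != 0.
  move: Pu; rewrite defP unitmx_mul unitmx_tr [X in _ && X]unitmxE unitfE.
  by case/andP.
rewrite det_Vandermonde => /prodf_neq0 eV i j eq_e.
have ne_lt (k l : 'I_n.+1) : e 0 k = e 0 l -> (k < l)%N = false.
  move=> ekl; apply/negP=> lt_kl; have /prodf_neq0/(_ l lt_kl) := eV k isT.
  by rewrite ekl subrr eqxx.
have := ne_lt _ _ eq_e; have := ne_lt _ _ (esym eq_e).
by case: ltngtP => // /val_inj.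
Qed.

(** The companion matrix with the order of the basis reversed, which puts the
    column of coefficients at index 0, where the block decompositions of type
    1 + m find it. *)
Definition column_companion (p : {poly F}) m : 'M[F]_m.+1 :=
  \matrix_(i, j) if j == 0 then - p`_(m - i) else (j == i.+1 :> nat)%:R.

Variables (p : {poly F}) (m : nat).
Hypotheses (p_monic : p \is monic) (size_p : size p = m.+2).

Lemma root_sum_coef z :
  root p z -> - (\sum_(l < m.+1) p`_l * z ^+ l) = z ^+ m.+1.
Proof.
move/rootP; rewrite horner_coef size_p big_ord_recr /=.
have -> : p`_m.+1 = 1 by rewrite -(monicP p_monic) lead_coefE size_p.
by rewrite mul1r => /eqP; rewrite addrC addr_eq0 => /eqP.
Qed.

Lemma column_companion_left_eigen z : root p z ->
  let u := \row_(j < m.+1) z ^+ (m - j) in u *m column_companion p m = z *: u.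
Proof.
move=> pz /=; apply/rowP=> j; rewrite !mxE.
case: (unliftP 0 j) => [j'|] ->.
  have i_lt : (j' < m.+1)%N by apply: ltnW; rewrite ltnS.
  rewrite (bigD1 (Ordinal i_lt)) //= big1 ?addr0 => [|i ne_i].
    by rewrite !mxE /= eqxx mulr1 /bump add1n -exprS -subSn // ltnS.
  rewrite !mxE /= /bump add1n eqSS eq_sym.
  by rewrite (negPf (ne_i : i != j' :> nat)) mulr0.
rewrite subn0 -exprS -(root_sum_coef pz) -sumrN (reindex_inj rev_ord_inj).
by apply: eq_bigr => i _; rewrite !mxE /= subSS subKn -1?ltnS // mulrN mulrC.
Qed.

(** With w_0 = 1, the row of index i says z w_i = w_(i+1) - p_(m-i), with
    w_(m+1) = 0. This determines w from its last entry on, and the value that it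
    gives to w_0 is 1 because z is a root of p. If z > 0 and all coefficients
    but the leading one are negative, then w is positive. *)
Lemma column_companion_right_eigen z : root p z -> z != 0 ->
  let w := \col_(i < m.+1)
    (- (\sum_(l < m.+1 - i) p`_l * z ^+ l) / z ^+ (m.+1 - i)) in
  column_companion p m *m w = z *: w.
Proof.
move=> pz z_neq0 /=; apply/colP=> i; rewrite !mxE.
pose y k := - (\sum_(l < k) p`_l * z ^+ l) / z ^+ k.
rewrite (eq_bigr (fun j => column_companion p m i j * y (m.+1 - j)%N)).
  2: by move=> j _; rewrite [X in _ * X]mxE.
rewrite big_ord_recl mxE /= subn0 {1}/y root_sum_coef //.
rewrite divff ?expf_neq0 // mulr1.
rewrite -/(y (m.+1 - i)%N) subSn -1?ltnS // mulrC {2}/y exprS invfM.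
rewrite [_ * z]mulrC mulrCA mulVKf // big_ord_recr /= opprD mulrDl.
rewrite -[- (p`_(m - i) * _)]mulNr mulfK ?expf_neq0 // addrC; congr (_ + _).
rewrite -/(y (m - i)%N).
have [lt_im | le_mi] := ltnP i m.
  rewrite (bigD1 (Ordinal lt_im)) //= big1 ?addr0 => [|j ne_j].
    by rewrite mxE /= /bump eqxx mul1r.
  by rewrite mxE /= /bump add1n eqSS (negPf (ne_j : j != i :> nat)) mul0r.
rewrite (eqP le_mi) /y big_ord0 oppr0 mul0r big1 // => j _.
by rewrite mxE /= /bump eqSS ltn_eqF ?mul0r // (leq_trans _ le_mi).
Qed.

End Companion.

Section CompanionBlock.
Variable R : realType.
Local Notation C := R[i].
Local Notation rc := (real_complex R).

(** Every column of a companion matrix but the last has a zero entry, so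
    the positive column is the one that holds the opposites of the
    coefficients. *)
Lemma diagonalizable_companion_spectrumP (G : seq C) :
    diagonalizable_companion_spectrum G ->
  exists p : {poly R}, [/\ p \is monic, size p = (size G).+1,
    map_poly rc p = \prod_(z <- G) ('X - z%:P), uniq G
    & forall i, (i < size G)%N -> p`_i < 0].
Proof.
case=> p p_monic [_ [j Aj_gt0] diagA AG].
have [P Pu /diagonalizable_forPex[e /(simmxP Pu) PA]] := diagA.
have pG : map_poly rc p = \prod_(z <- G) ('X - z%:P).
  rewrite -{1}(companionmxK p_monic) -char_poly_trmx -AG.
  by rewrite -/(companion_column p) map_char_poly.
have size_p : size p = (size G).+1.
  by rewrite -(size_map_poly rc) pG size_prod_XsubC.
exists p; split=> //.
  have inj_e : injective (e 0).
    apply: unit_subdiagonal_diagonal_uniq Pu PA => k l lt_l.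
    rewrite !mxE ltn_eqF; last by rewrite -ltnS prednK // (leq_trans _ lt_l).
    by rewrite eq_sym rmorph_nat.
  have: \prod_(z <- G) ('X - z%:P) =
      \prod_(z <- [seq e 0 i | i <- enum 'I_(size p).-1]) ('X - z%:P).
    rewrite -AG (intertwined_char_poly Pu PA).
    rewrite char_poly_trig ?diag_mx_is_trig //.
    by rewrite big_map big_enum; apply: eq_bigr => i _; rewrite mxE eqxx.
  move/prod_XsubC_eq/perm_uniq->; rewrite map_inj_uniq ?enum_uniq //.
have last_j : j = (size p).-1.-1 :> nat.
  apply/eqP; have := Aj_gt0 j; rewrite !mxE; case: eqP => // _.
  by rewrite gtn_eqF // ltxx.
move=> i lt_iG; have lt_i : (i < (size p).-1)%N by rewrite size_p.
by have := Aj_gt0 (Ordinal lt_i); rewrite !mxE -last_j eqxx oppr_gt0.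
Qed.

Lemma companion_perron_block (c : R) s :
    0 < c -> diagonalizable_companion_spectrum (rc c :: s) ->
  perron_block (rc c) (s1 (rc c :: s)) s.
Proof.
set G := rc c :: s; move=> c_gt0 /diagonalizable_companion_spectrumP.
case=> p [p_monic size_p pG Gu p_lt0].
pose m := size s; pose q := map_poly rc p.
have q_monic : q \is monic by rewrite map_monic.
have size_q : size q = m.+2 by rewrite size_map_poly.
have rootG (k : 'I_m.+1) : root q G`_k.
  by rewrite /q pG root_prod_XsubC mem_nth.
have root_c : root p c by rewrite -(fmorph_root rc) (rootG ord0).
pose B := column_companion p m.
have CB : complexify B = column_companion q m.
  apply/matrixP=> i j; rewrite !mxE coef_map /=.
  by case: eqP => _; rewrite ?rmorphN ?rmorph_nat.
have B_ge0 : nonnegative_mx B.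
  move=> i j; rewrite mxE; case: eqP => _ //.
  by rewrite oppr_ge0 ltW // p_lt0 //= ltnS leq_subr.
have B0_gt0 i : 0 < B i 0.
  by rewrite mxE eqxx oppr_gt0 p_lt0 //= ltnS leq_subr.
pose V : 'M[C]_(1 + m) := \matrix_(k, j) G`_k ^+ (m - j).
pose dG : 'rV[C]_m.+1 := \row_k G`_k.
have VB : V *m complexify B = diag_mx dG *m V.
  apply/row_matrixP=> k; rewrite row_mul CB.
  have -> : row k V = \row_j G`_k ^+ (m - j) by apply/rowP=> j; rewrite !mxE.
  rewrite (column_companion_left_eigen q_monic size_q (rootG k)).
  by apply/rowP=> j; rewrite mul_diag_mx !mxE.
have Vu : V \in unitmx.
  have -> : V = col_perm (perm rev_ord_inj) (Vandermonde m.+1 dG)^T.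
    by apply/matrixP=> k j; rewrite !mxE permE /= subSS.
  rewrite col_permE unitmx_mul unitmx_tr unitmx_perm andbT.
  rewrite unitmxE unitfE det_Vandermonde; apply/prodf_neq0 => i _.
  apply/prodf_neq0 => j lt_ij; rewrite !mxE subr_eq0 nth_uniq //.
  by rewrite gtn_eqF.
pose u : 'rV[R]_m.+1 := \row_j c ^+ (m - j).
pose w0 := \col_(i < m.+1)
  (- (\sum_(l < m.+1 - i) p`_l * c ^+ l) / c ^+ (m.+1 - i)).
have Bw0 : B *m w0 = c *: w0.
  by apply: column_companion_right_eigen; rewrite ?gt_eqF.
have u_gt0 j : 0 < u 0 j by rewrite mxE exprn_gt0.
have w0_gt0 i : 0 < w0 i 0.
  rewrite mxE divr_gt0 ?exprn_gt0 // -sumrN.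
  have term_gt0 (l : 'I_(m.+1 - i)) : 0 < - (p`_l * c ^+ l).
    rewrite oppr_gt0 pmulr_llt0 ?exprn_gt0 // p_lt0 //=.
    exact: leq_trans (ltn_ord l) (leq_subr _ _).
  have i_lt : (0 < m.+1 - i)%N by rewrite subn_gt0.
  rewrite (bigD1 (Ordinal i_lt)) //= ltr_pwDl ?sumr_ge0 //.
    exact: (term_gt0 (Ordinal i_lt)).
  by move=> l _; apply: ltW.
pose x := (u *m w0) 0 0.
have x_gt0 : 0 < x.
  rewrite /x mxE big_ord_recl ltr_pwDl ?mulr_gt0 // sumr_ge0 // => i _.
  by rewrite ltW // mulr_gt0.
pose w := x^-1 *: w0.
have w_gt0 i : 0 < w i 0 by rewrite mxE mulr_gt0 ?invr_gt0.
have uw : u *m w = 1%:M.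
  rewrite -scalemxAr [u *m w0]mx11_scalar -/x -scalemx1 scalerA.
  by rewrite mulVf ?gt_eqF // scale1r.
have Bw : B *m w = c *: w by rewrite -scalemxAr Bw0 !scalerA mulrC.
have usub : usubmx (V : 'M_(1 + m, 1 + m)) = complexify u.
  by apply/rowP=> j; rewrite !mxE rmorphXn.
(* The entry of V w at k vanishes unless the eigenvalues at k and at 0 agree,
   and G has no repetition; so w is the first column of the inverse of V. *)
have Vw : V *m complexify w = delta_mx 0 0.
  apply/colP=> k; have [-> | k_neq0] := eqVneq k 0.
    have /matrixP/(_ 0 0) : complexify u *m complexify w = 1%:M.
      by rewrite -complexifyM uw; apply: map_mx1.
    rewrite -usub !mxE eqxx => <-; apply: eq_bigr => i _.
    by congr (_ * _); rewrite !mxE.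
  have : (V *m (complexify B *m complexify w)) k 0 =
      (V *m complexify (c *: w)) k 0.
    by rewrite -complexifyM Bw.
  rewrite mulmxA VB -mulmxA mul_diag_mx (complexifyZ c w) -scalemxAr.
  move: (V *m complexify w) => y; rewrite !mxE => /eqP.
  rewrite -subr_eq0 -mulrBl mulf_eq0 => /orP[|/eqP->].
    rewrite subr_eq0 -[rc c]/(G`_0) nth_uniq //.
    by move: k_neq0; rewrite -val_eqE => /negPf->.
  by rewrite (negPf k_neq0).
have lsub : lsubmx (invmx V : 'M_(1 + m, 1 + m)) = complexify w.
  rewrite -[RHS](mulKmx Vu) Vw -colE; apply/colP=> i; rewrite [LHS]mxE [RHS]mxE.
  by congr (invmx V _ _); apply: val_inj.
have dB : diagonalized_by (complexify B)
   (row_mx (complexify w) (rsubmx (invmx V : 'M_(1 + m, 1 + m))))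
   (col_mx (complexify u) (dsubmx (V : 'M_(1 + m, 1 + m))))
   (row_mx (rc c)%:M (\row_(i < m) s`_i)).
  rewrite -lsub -usub hsubmxK vsubmxK; split; rewrite ?mulmxV ?mulVmx //.
  have -> : row_mx (rc c)%:M (\row_(i < m) s`_i) = dG.
    apply/rowP=> i; rewrite -(@splitK 1 m i); case: (@split 1 m i) => j /=.
      by rewrite row_mxEl !mxE !ord1 eqxx.
    by rewrite row_mxEr !mxE.
  by rewrite -[LHS](mulKmx Vu) (mulmxA V) VB -!mulmxA mulmxV // mulmx1.
apply: PerronBlock B_ge0 B0_gt0 _ w_gt0 u_gt0 dB _.
  rewrite mxE eqxx subn0 rmorphN /= -coef_map /=.
  by have := @coefPn_prod_XsubC _ G isT; rewrite -pG => ->; rewrite opprK.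
rewrite (big_nth 0) big_mkord; apply: eq_bigr => i _.
by rewrite mxE.
Qed.

Lemma perron_block_of_companion (c : C) s :
    0 < c -> diagonalizable_companion_spectrum (c :: s) ->
  perron_block c (s1 (c :: s)) s.
Proof.
move=> c_gt0; have defc := RRe_real (gtr0_real c_gt0).
by rewrite -defc ltcR in c_gt0 *; apply: companion_perron_block.
Qed.

Lemma companion_chain_diagonalization (lam : C) Ls k :
    0 < lam -> head [::] Ls != [::] -> head 0 (head [::] Ls) = lam ->
    (forall l, (l < size Ls)%N ->
       diagonalizable_companion_spectrum (auxiliary_list Ls l)) ->
    (k < size Ls)%N ->
  perron_diagonalization lam (s1 (auxiliary_list Ls k))
    (flatten (take k.+1 Ls)).
Proof.
move=> lam_gt0 L1_neq0 lamE compL; elim: k => [|k IHk] lt_k.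
  case: Ls lt_k L1_neq0 lamE compL => [|[|_ L] Ls] //= _ _ -> compL.
  rewrite take0 /= cats0; apply: perron_block_diagonalization.
  exact: perron_block_of_companion (compL 0 _).
have IH := IHk (ltnW lt_k).
have -> : flatten (take k.+2 Ls) = flatten (take k.+1 Ls) ++ nth [::] Ls k.+1.
  by rewrite (take_nth [::] lt_k) flatten_rcons.
apply: (perron_diagonalization_glue IH (perron_block_of_companion _ _)).
  exact: perron_diagonalization_gt0 IH.
exact: compL lt_k.
Qed.

End CompanionBlock.

Theorem corollary3p2 (R : realType) (lambda1 : R[i]) (lambdas : seq R[i])
  (Ls : seq (seq R[i]))
  (Lambda_realizable : realizable (lambda1 :: lambdas))
  (lambda1_gt0 : 0 < lambda1)
  (lambdas_Re_le0 : forall z, z \in lambdas -> complex.Re z <= 0)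
  (lambdas_neq0 : forall z, z \in lambdas -> z != 0)
  (s1_gt0 : 0 < s1 (lambda1 :: lambdas))
  (Ls_decomposition : perm_eq (lambda1 :: lambdas) (flatten Ls))
  (Ls_nonempty : forall L, L \in Ls -> (0 < size L)%N)
  (lambda11E : head 0 (head [::] Ls) = lambda1)
  (Gamma_companion : forall k, (k < size Ls)%N ->
     diagonalizable_companion_spectrum (auxiliary_list Ls k)) :
  universally_realizable (lambda1 :: lambdas).
Proof.
have Ls_gt0 : (0 < size Ls)%N.
  rewrite lt0n size_eq0; apply: contraL Ls_decomposition => /eqP->.
  by apply/negP=> /perm_size.
have L1_neq0 : head [::] Ls != [::].
  by rewrite -size_eq0 -lt0n Ls_nonempty // -nth0 mem_nth.
apply: (@perron_diagonalization_universally_realizable _ _ _ _ (flatten Ls));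
  rewrite //.
rewrite -[Ls in flatten Ls]take_size -(prednK Ls_gt0).
by apply: companion_chain_diagonalization; rewrite ?prednK.
Qed.
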